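(* Every weakly Lindelöf GO space is Lindelöf.
   Context: All spaces are topological spaces assumed to be $T_1$. A space is a generalized ordered space (GO space) if it is homeomorphic to a subspace of a linearly ordered topological space (a linearly ordered set with its order topology). A space is Lindelöf if every open cover has a countable subcover. A space $X$ is weakly Lindelöf if for every open cover $\mathcal{U}$ of $X$ there is a countable $\mathcal{U}'\subset\mathcal{U}$ such that $\bigcup\mathcal{U}'$ is dense in $X$. *)

(* Defs.v *)
From mathcomp Require Import all_boot all_order.
From mathcomp Require Import all_classical topology.

Set Implicit Arguments.
Unset Strict Implicit.
Unset Printing Implicit Defensive.

Local Open Scope classical_set_scope.

Definition homeomorphic (X Y : topologicalType) : Prop :=
  exists (f : X -> Y) (g : Y -> X),
    [/\ continuous f, continuous g, cancel f g & cancel g f].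

(* The carrier [set_type A] of a set [A : set L] has the subspace topology. *)
Definition GO_space (X : topologicalType) : Prop :=
  exists (d : Order.disp_t) (L : orderTopologicalType d) (A : set L),
    homeomorphic X (set_type A).

Definition open_cover (X : topologicalType) (U : set (set X)) : Prop :=
  U `<=` open /\ \bigcup_(u in U) u = [set: X].

Definition lindelof (X : topologicalType) : Prop :=
  forall U : set (set X), open_cover U ->
    exists V : set (set X),
      [/\ V `<=` U, countable V & \bigcup_(v in V) v = [set: X]].

Definition weakly_lindelof (X : topologicalType) : Prop :=
  forall U : set (set X), open_cover U ->
    exists V : set (set X),
      [/\ V `<=` U, countable V & dense (\bigcup_(v in V) v)].

(* Main.v *)
Require Import Defs.
From mathcomp Require Import all_boot all_order.
From mathcomp Require Import interval.
From mathcomp Require Import all_classical topology.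

Set Implicit Arguments.
Unset Strict Implicit.
Unset Printing Implicit Defensive.

Import Order.TTheory.
Local Open Scope classical_set_scope.
Local Open Scope order_scope.

(** Fix an open cover [U]. Call two points equivalent when the order interval
    between them is covered by countably many members of [U]. Intervals compose,
    so this is an equivalence relation; its classes are convex, and they are
    open because each point has a convex neighbourhood inside one member of [U].

    Weak Lindelöfness then gives a countable set that is cofinal in every class
    at once ([countable_cofinal]). The idea is the following. In a class without
    a maximum, the sets of points of the class lying below [b], for [b] in the
    class, form an open cover; if the union of some of them is dense, then the
    corresponding [b]s are cofinal, since a point [x] above all of them would
    leave the nonempty open set of points of the class above [x] unmet. A class
    with a maximum is taken whole, indexed by that maximum. All these
    sets together cover the space, and since the classes are open and disjoint
    an open part of one class can only be met by sets chosen from that class.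
    Hence one use of weak Lindelöfness handles every class; in particular there
    are only countably many of them.

    Applied to the reversed order, the same lemma gives a countable coinitial
    set. Every point therefore lies between two equivalent points taken from two
    fixed countable sets. There are countably many such pairs, and the interval
    of each is covered by countably many members of [U]. *)

Definition countably_covered (X : Type) (U : set (set X)) (S : set X) : Prop :=
  exists V : set (set X),
    [/\ V `<=` U, countable V & S `<=` \bigcup_(v in V) v].

Lemma countably_covered_sub (X : Type) (U : set (set X)) (S T : set X) :
  S `<=` T -> countably_covered U T -> countably_covered U S.
Proof. by move=> ST [V [VU cV TV]]; exists V; split => //; exact: subset_trans TV. Qed.

Lemma countably_covered_bigcup (X I : Type) (U : set (set X)) (D : set I)
    (F : I -> set X) :
  countable D -> (forall i, D i -> countably_covered U (F i)) ->
  countably_covered U (\bigcup_(i in D) F i).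
Proof.
move=> cD FU.
have /choice[V VP] (i : I) : exists V : set (set X), D i ->
    [/\ V `<=` U, countable V & F i `<=` \bigcup_(v in V) v].
  have [/FU[V VP]|nDi] := pselect (D i); first by exists V.
  by exists set0 => /nDi.
exists (\bigcup_(i in D) V i); split.
- by move=> v [i Di Viv]; have [VU _ _] := VP i Di; exact: VU.
- by apply: bigcup_countable => // i Di; have [] := VP i Di.
- move=> x [i Di Fix]; have [_ _ /(_ x Fix)[v Vv vx]] := VP i Di.
  by exists v => //; exists i.
Qed.

Lemma countably_coveredU (X : Type) (U : set (set X)) (S T : set X) :
  countably_covered U S -> countably_covered U T ->
  countably_covered U (S `|` T).
Proof.
move=> US UT.
apply: (@countably_covered_sub _ _ _ (\bigcup_(b in [set: bool]) if b then S else T)).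
  by move=> x [Sx|Tx]; [exists true|exists false].
by apply: countably_covered_bigcup => // -[].
Qed.

(** Selecting indices rather than members of the cover matters below, where the
    indices are points of the space and carry the cofinality argument. *)
Lemma weakly_lindelof_family (X : topologicalType) (I : Type) (D : set I)
    (W : I -> set X) :
  weakly_lindelof X -> (forall i, D i -> open (W i)) ->
  (forall x, exists2 i, D i & W i x) ->
  exists B : set I,
    [/\ B `<=` D, countable B & dense (\bigcup_(i in B) W i)].
Proof.
move=> wX Wop Wcov.
have [|V [VW cV dV]] := wX (W @` D).
  split; first by move=> _ [i Di <-]; exact: Wop.
  rewrite -subTset => x _; have [i Di Wix] := Wcov x.
  by exists (W i) => //; exists i.
have [i0|noI] := pselect (exists i : I, True); last first.
  exists set0; split => // O [x _] _.
  by have [i] := Wcov x; case: noI; exists i.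
have /choice[c cP] (v : set X) : exists i : I, V v -> D i /\ W i = v.
  have [/VW[i Di Wi]|nVv] := pselect (V v); first by exists i.
  by have [i _] := i0; exists i => /nVv.
exists (c @` V); split.
- by move=> _ [v Vv <-]; have [] := cP v Vv.
- exact: (sub_countable (card_image_le _ _)).
- move=> O O0 oO; have [x [Ox [v Vv vx]]] := dV O O0 oO.
  exists x; split => //; exists (c v); first by exists v.
  by have [_ ->] := cP v Vv.
Qed.

(** The order enters only as a transitive irreflexive relation with open rays, so
    that the lemma applies to an order and to its converse alike. Without
    totality, [x <= b] has to be read as [~ lt b x]. *)
Lemma countable_cofinal (X : topologicalType) (lt E : X -> X -> Prop) :
  weakly_lindelof X ->
  (forall x y z, lt x y -> lt y z -> lt x z) -> (forall x, ~ lt x x) ->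
  (forall x, open [set y | lt y x]) -> (forall x, open [set y | lt x y]) ->
  (forall x, E x x) -> (forall x y, E x y -> E y x) ->
  (forall x y z, E x y -> E y z -> E x z) ->
  (forall x, open [set y | E x y]) ->
  exists2 B : set X, countable B &
    forall x, exists2 b, B b & E x b /\ ~ lt b x.
Proof.
move=> wX lttr ltirr ltop gtop Erefl Esym Etr Eop.
(* [M] is the set of points that are maximal in their class. A class with a
   maximal point contributes only such points to the index set [D], and then
   [W b] is the whole class. With its other points as indices too, a subfamily
   could have a dense union while all its indices stay below the maximum. *)
pose M : set X := [set m | forall z, E m z -> ~ lt m z].
pose D := [set b | M b \/ forall z, E b z -> ~ M z].
pose W b := [set y | E b y /\ (lt y b \/ M b)].
have half_open c (R : set X) (P : Prop) :
    open R -> open [set y | E c y /\ (R y \/ P)].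
  move=> oR; rewrite (_ : [set y | _] = [set y | E c y] `&` (R `|` [set _ | P])) //.
  apply: openI => //; apply: openU => //.
  have [p|np] := pselect P.
    by rewrite (_ : [set _ | P] = setT); [exact: openT|apply/seteqP; split].
  by rewrite (_ : [set _ | P] = set0); [exact: open0|apply/seteqP; split].
have Wop b : open (W b) by exact: (half_open b [set y | lt y b]).
have greater x : ~ M x -> exists2 y, E x y & lt x y.
  by move/existsNP => [y /not_implyP[Exy /contrapT xy]]; exists y.
have [||B [BD cB dB]] := @weakly_lindelof_family X X D W wX.
- by move=> b _.
- move=> x; have [[m [Exm Mm]]|noM] := pselect (exists m, E x m /\ M m).
    by exists m; [left|split; [exact: Esym|right]].
  have DE y : E x y -> D y.
    by move=> Exy; right=> z Eyz Mz; apply: noM; exists z; split => //; exact: Etr Eyz.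
  have [|y Exy xy] := greater x; first by move=> Mx; apply: noM; exists x.
  by exists y; [exact: DE|split; [exact: Esym|left]].
exists B => // x.
(* The part of the class of [x] strictly above [x], or the whole class when [x]
   is maximal in it: in both cases nonempty, so some [W b] meets it. *)
pose O := [set y | E x y /\ (lt x y \/ M x)].
have oO : open O by exact: (half_open x [set y | lt x y]).
have O0 : O !=set0.
  have [Mx|/greater[y Exy xy]] := pselect (M x).
    by exists x; split => //; right.
  by exists y; split => //; left.
have [y [[Exy xyM] [b Bb [Eby ybM]]]] := dB O O0 oO.
have Exb : E x b by apply: Etr Exy _; exact: Esym.
exists b => //; split => // bx.
have nMb : ~ M b by move=> /(_ x (Esym _ _ Exb)).
have yb : lt y b by case: ybM.
have nMx : ~ M x.
  by case: (BD b Bb) => // nM; apply: nM; exact: Esym.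
have xy : lt x y by case: xyM.
exact: ltirr (lttr _ _ _ bx (lttr _ _ _ xy yb)).
Qed.

Lemma itv_convex (d : Order.disp_t) (L : porderType d) (i : interval L)
    (a b c : L) :
  a \in i -> b \in i -> a <= c <= b -> c \in i.
Proof.
case: i => l r; rewrite !itv_boundlr => /andP[la _] /andP[_ br] /andP[ac cb].
apply/andP; split.
  by apply: le_trans la _; rewrite bnd_simp.
by apply: le_trans _ br; rewrite bnd_simp.
Qed.

(** What is used of a GO space: it maps continuously to a linear order in such a
    way that every point has arbitrarily small neighbourhoods that are convex for
    the order pulled back from [L]. *)
Lemma GO_space_map (X : topologicalType) : GO_space X ->
  exists (d : Order.disp_t) (L : orderTopologicalType d) (k : X -> L),
    continuous k /\ forall (x : X) (O : set X), nbhs x O ->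
      exists N : set X, [/\ nbhs x N, N `<=` O &
        forall a b c, N a -> N b -> k a <= k c <= k b -> N c].
Proof.
move=> [d [L [A [f [g [fc gc fK gK]]]]]].
have kc : continuous (fun x => set_val (f x)).
  move=> x; apply: (@continuous_comp _ _ _ f set_val); first exact: fc.
  exact: initial_continuous.
exists d, L, (fun x => set_val (f x)); split => // x O xO.
have : nbhs (f x) (g @^-1` O) by apply: gc; rewrite fK.
move=> [_ [[B oB <-] Bfx BO]].
have : nbhs (set_val (f x)) B by exact: open_nbhs_nbhs.
rewrite itv_nbhsE => -[i [io xi] iB].
exists ((fun x => set_val (f x)) @^-1` [set` i]); split.
- apply: kc; apply: open_nbhs_nbhs; split => //; exact: itv_open_ends_open.
- move=> y /= yi; have := BO (f y); rewrite /= fK; apply; exact: iB.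
- move=> a b c /= ai bi acb; exact: itv_convex ai bi acb.
Qed.

Theorem corollary3p20 (X : topologicalType) :
  accessible_space X -> GO_space X -> weakly_lindelof X -> lindelof X.
Proof.
move=> _ /GO_space_map[d [L [k [kc knbhs]]]] wX U [Uop Ucov].
pose hull x y := [set z | (k x <= k z <= k y) || (k y <= k z <= k x)].
pose E x y := countably_covered U (hull x y).
have hullC x y : hull x y = hull y x.
  by apply/seteqP; split => z; rewrite /hull /= orbC.
have Esym x y : E x y -> E y x by rewrite /E hullC.
have Etr x y z : E x y -> E y z -> E x z.
  move=> Exy Eyz; apply: countably_covered_sub (countably_coveredU Exy Eyz).
  move=> t; rewrite /hull /=.
  have [ty|/ltW yt] := leP (k t) (k y) => /orP[]/andP[-> ->].
  - by left.
  - by right; rewrite orbT.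
  - by right; rewrite yt.
  - by left; rewrite yt orbT.
(* A convex neighbourhood inside one [u] in [U] contains the interval from [x] to
   each of its points, so [u] alone covers that interval. *)
have Enbhs (x : X) : nbhs x [set y | E x y].
  have : (\bigcup_(u in U) u) x by rewrite Ucov.
  move=> [u Uu ux].
  have /knbhs[N [xN Nu Nconv]] : nbhs x u.
    by apply: open_nbhs_nbhs; split => //; exact: Uop.
  have Nx : N x := nbhs_singleton xN.
  apply: filterS xN => y Ny; exists [set u]; split.
  - by move=> _ ->.
  - exact: countable1.
  - move=> z hz; exists u => //; apply: Nu.
    by case/orP: hz; [exact: Nconv|exact: Nconv].
have Erefl x : E x x := nbhs_singleton (Enbhs x).
have Eop x : open [set y | E x y].
  rewrite openE => y /= Exy; rewrite /interior.
  by apply: filterS (Enbhs y) => z; exact: Etr.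
have ltop x : open [set y | k y < k x].
  rewrite (_ : [set y | _] = k @^-1` `]-oo, k x[); last first.
    by apply/seteqP; split => y; rewrite /= in_itv /=.
  by apply: open_comp => [y _|]; [exact: kc|exact: lray_open].
have gtop x : open [set y | k x < k y].
  rewrite (_ : [set y | _] = k @^-1` `]k x, +oo[); last first.
    by apply/seteqP; split => y; rewrite /= in_itv /= andbT.
  by apply: open_comp => [y _|]; [exact: kc|exact: rray_open].
have [B cB cofB] := @countable_cofinal X (fun x y => k x < k y) E wX
  (fun x y z => @lt_trans _ _ (k y) (k x) (k z))
  (fun x => elimF idP (ltxx (k x))) ltop gtop Erefl Esym Etr Eop.
have [A cA coinA] := @countable_cofinal X (fun x y => k y < k x) E wX
  (fun x y z xy yz => lt_trans yz xy)
  (fun x => elimF idP (ltxx (k x))) gtop ltop Erefl Esym Etr Eop.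
suff [V [VU cV TV]] : countably_covered U [set: X].
  by exists V; split => //; apply/seteqP; split.
pose P := [set p | (A `*` B) p /\ E p.1 p.2].
apply: (@countably_covered_sub _ _ _ (\bigcup_(p in P) hull p.1 p.2)).
  move=> x _; have [b Bb [Exb /negP bx]] := cofB x.
  have [a Aa [Exa /negP xa]] := coinA x.
  exists (a, b); first by split => //=; exact: Etr (Esym _ _ Exa) Exb.
  by apply/orP; left; rewrite !leNgt xa bx.
apply: countably_covered_bigcup => [|p []//].
by apply: sub_countable (countableX cA cB); apply: subset_card_le => p [].
Qed.
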